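(* Let $n\ge 1$, $C>0$, $\mu>0$, and let $f_1,\dots,f_n:[0,\infty)\to\mathbb{R}$ be increasing and $\mu$-strongly convex (i.e. $f_k''(x)\ge\mu$ for all $x\ge 0$). Let $(P)$, $(D)$, $f$, $\varphi$, $x_k(\cdot)$, $p_{max}$ and $L_\psi=n/\mu$ be as in the context. Let $x^*$ be the $x$-component of an optimal solution of $(P)$ and let $p^*$ be an optimal solution of $(D)$. Let the composite gradient method described in the context be run for $N\ge 1$ steps from a starting point $p^0\in\mathbb{R}^n$ satisfying $0\le p_k^0\le p_{max}$ for $k=1,\dots,n$, producing $p^1,\dots,p^N$. Put $$\hat p^{N}=\frac1N\sum_{t=1}^{N}p^{t},\qquad \hat x^{N}=\frac1N\sum_{t=0}^{N-1}x(p^{t}).$$ Then $$f(\hat x^N)-f(x^* )\le f(\hat x^N)+\varphi(p^* )\le \varphi(\hat p^N)+f(\hat x^N)\le \frac{82\,p_{max}^2n^2}{N\mu},$$ $$\Big[C-\sum_{k=1}^n \hat x_k^N\Big]_+\le \frac{82\,p_{max}n^2}{3N\mu}.$$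
   Context: Notation: $[a]_+=(a)_+=\max(a,0)$. Primal problem $(P)$: minimize $f(x)=\sum_{k=1}^n f_k(x_k)$ over $x,y\in\mathbb{R}^n$ subject to $\sum_{k=1}^n y_k\ge C$, $x_k\ge y_k$, $y_k\ge0$, $x_k\ge0$ for $k=1,\dots,n$. For $p_k\ge 0$ let $x_k(p_k)=\arg\max_{x_k\ge0}\{p_kx_k-f_k(x_k)\}$, and for $p\ge 0$ (componentwise) let $x(p)=(x_1(p_1),\dots,x_n(p_n))$. Dual problem $(D)$ (up to sign): minimize over $p\in\mathbb{R}^n$, $p\ge0$, the function $$\varphi(p)=\sum_{k=1}^n\{p_kx_k(p_k)-f_k(x_k(p_k))\}-C\min_{k=1,\dots,n}p_k.$$ Constants: $L_\psi=n/\mu$ and $p_{max}=\frac nC\left(\sum_{k=1}^n f_k\left(\frac{2C}{n}\right)-\sum_{k=1}^n f_k(0)\right)$. Composite gradient method: given $p^t\ge0$, compute $x_k(p_k^t)$ for all $k$; set $\tilde p_k^{t+1}=p_k^t-\frac1{L_\psi}x_k(p_k^t)$; if $\sum_{k=1}^n(-\tilde p_k^{t+1})_+\ge C/L_\psi$ put $p_{center}^{t+1}=0$, otherwise let $p_{center}^{t+1}>0$ be the solution of $\sum_{k=1}^n(p_{center}^{t+1}-\tilde p_k^{t+1})_+=C/L_\psi$; finally set $p_k^{t+1}=\max(p_{center}^{t+1},\tilde p_k^{t+1})$ for $k=1,\dots,n$. *)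

(* Defs.v *)
From HB Require Import structures.
From mathcomp Require Import all_boot all_order all_algebra.
From mathcomp Require Import all_classical all_reals all_analysis.

Set Implicit Arguments.
Unset Strict Implicit.
Unset Printing Implicit Defensive.

Import Order.TTheory GRing.Theory Num.Theory.
Import numFieldNormedType.Exports.

Local Open Scope classical_set_scope.
Local Open Scope ring_scope.

(* A function [0, +oo) -> R is represented by a total function R -> R; every
   definition below uses its values on [0, +oo) only. *)

Section one_variable.
Variable R : realType.
Implicit Types (f : R -> R) (x l p mu : R).

Definition pos_part (a : R) : R := Num.max a 0.

(* Derivative of a function on [0, +oo): two-sided at x > 0, right-sided at
   x = 0. *)
Definition has_derivative_ge0 f x l : Prop :=
  (f y - f x) / (y - x) @[y --> within [set y | 0 <= y] x^'] --> l.

(* Non-strict; strictness follows from f'' >= mu > 0. *)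
Definition increasing_ge0 f : Prop :=
  forall x y, 0 <= x -> x <= y -> f x <= f y.

(* f is twice differentiable on [0, +oo) and f'' >= mu there. *)
Definition strongly_convex_ge0 mu f : Prop :=
  exists df ddf : R -> R,
    [/\ forall x, 0 <= x -> has_derivative_ge0 f x (df x),
        forall x, 0 <= x -> has_derivative_ge0 df x (ddf x) &
        forall x, 0 <= x -> mu <= ddf x].

Definition is_best_response f p x : Prop :=
  0 <= x /\ forall z, 0 <= z -> p * z - f z <= p * x - f x.

(* argmax_(x >= 0) (p x - f x); for continuous f with f'' >= mu > 0 the maximizer
   exists and is unique, so the default value 0 plays no role. *)
Definition best_response f p : R := xget 0 [set x | is_best_response f p x].

End one_variable.

Section resource_allocation.
Variables (R : realType) (n : nat).
Implicit Types (f : 'I_n -> R -> R) (C mu c : R) (x y p q : 'rV[R]_n).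

Definition nonneg_vec p : Prop := forall k, 0 <= p 0 k.

Definition primal_obj f x : R := \sum_(k < n) f k (x 0 k).

Definition primal_feasible C x y : Prop :=
  [/\ C <= \sum_(k < n) y 0 k,
      forall k, y 0 k <= x 0 k,
      nonneg_vec y &
      nonneg_vec x].

Definition primal_optimal f C x y : Prop :=
  primal_feasible C x y /\
  forall x' y', primal_feasible C x' y' -> primal_obj f x <= primal_obj f x'.

Definition response f p : 'rV[R]_n := \row_k best_response (f k) (p 0 k).

(* The minimum of the entries of p; n > 0 supplies the initial entry. *)
Definition min_entry (n_gt0 : (0 < n)%N) p : R :=
  \big[Num.min/p 0 (Ordinal n_gt0)]_(k < n) p 0 k.

Definition dual_obj (n_gt0 : (0 < n)%N) f C p : R :=
  \sum_(k < n) (p 0 k * response f p 0 k - f k (response f p 0 k))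
  - C * min_entry n_gt0 p.

Definition dual_optimal (n_gt0 : (0 < n)%N) f C p : Prop :=
  nonneg_vec p /\
  forall q, nonneg_vec q -> dual_obj n_gt0 f C p <= dual_obj n_gt0 f C q.

Definition Lpsi mu : R := n%:R / mu.

Definition pmax f C : R :=
  n%:R / C * (\sum_(k < n) f k (2 * C / n%:R) - \sum_(k < n) f k 0).

Definition gradient_step f mu p : 'rV[R]_n :=
  p - (Lpsi mu)^-1 *: response f p.

Definition is_pcenter C mu q c : Prop :=
  if C / Lpsi mu <= \sum_(k < n) pos_part (- q 0 k) then c = 0
  else 0 < c /\ \sum_(k < n) pos_part (c - q 0 k) = C / Lpsi mu.

Definition composite_step f C mu p p' : Prop :=
  exists c, is_pcenter C mu (gradient_step f mu p) c /\
            forall k, p' 0 k = Num.max c (gradient_step f mu p 0 k).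

Definition composite_run f C mu (N : nat) (p : nat -> 'rV[R]_n) : Prop :=
  forall t, (t < N)%N -> composite_step f C mu (p t) (p t.+1).

Definition p_avg (N : nat) (p : nat -> 'rV[R]_n) : 'rV[R]_n :=
  N%:R^-1 *: \sum_(1 <= t < N.+1) p t.

Definition x_avg f (N : nat) (p : nat -> 'rV[R]_n) : 'rV[R]_n :=
  N%:R^-1 *: \sum_(0 <= t < N) response f (p t).

End resource_allocation.

(* Main.v *)
(* The conjugates of the f_k are (1/mu)-smooth, so one composite step decreases
   the dual in the usual way: testing the prox optimality against the constant
   vector (a, ..., a), summing over the steps and applying Jensen's inequality,

     phi(phat) + f(xhat) + a (C - sum_k xhat_k)
       <= Lpsi / (2 N) * |(a, ..., a) - p^0|^2     for every a >= 0.

   Taking a = 0 bounds the duality gap.  For the constraint violation s, moving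
   xhat towards the strictly feasible point (2C/n, ..., 2C/n) gives the weak
   duality estimate phi(phat) + f(xhat) >= - s pmax / n, which is combined with
   the bound above at a = 2 pmax; strong duality is never needed. *)

Require Import Defs.
From HB Require Import structures.
From mathcomp Require Import all_boot all_order all_algebra.
From mathcomp Require Import all_classical all_reals all_analysis.
From mathcomp Require Import ring lra.

Set Implicit Arguments.
Unset Strict Implicit.
Unset Printing Implicit Defensive.

Import Order.TTheory GRing.Theory Num.Theory.
Import numFieldNormedType.Exports.

Local Open Scope ring_scope.

(** * One-sided differential calculus on the half-line *)

Section calculus_ge0.
Local Open Scope classical_set_scope.
Variable R : realType.
Implicit Types (f df : R -> R) (x y l p mu : R).

(** Clearing the denominator gives a first-order expansion in which [y = x] needs no exclusion. *)
Lemma has_derivative_ge0P f x l :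
  has_derivative_ge0 f x l <->
  forall e, 0 < e -> exists2 d, 0 < d &
    forall y, 0 <= y -> `|y - x| < d ->
      `|f y - f x - l * (y - x)| <= e * `|y - x|.
Proof.
rewrite /has_derivative_ge0; split=> [/cvgrPdist_le fx e e0|fx].
  have /nbhs_ballP[d /= d0 dP] := fx e e0.
  exists d => // y y0 yxd; have [->|yx] := eqVneq y x.
    by rewrite !subrr mulr0 subrr normr0 mulr0.
  have /= := dP y; rewrite -ball_normE /= distrC yxd => /(_ isT yx y0).
  rewrite -normrN opprB -(@ler_pM2r _ `|y - x|) ?normr_gt0 ?subr_eq0//.
  by rewrite -normrM mulrBl divfK ?subr_eq0.
apply/cvgrPdist_le => e e0; have [d d0 dP] := fx e e0.
apply/nbhs_ballP; exists d => //= y; rewrite -ball_normE /= distrC => yxd yx y0.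
rewrite -normrN opprB -(@ler_pM2r _ `|y - x|) ?normr_gt0 ?subr_eq0//.
by rewrite -normrM mulrBl divfK ?subr_eq0//; exact: dP.
Qed.

Lemma has_derivative_ge0B f g x l m :
  has_derivative_ge0 f x l -> has_derivative_ge0 g x m ->
  has_derivative_ge0 (fun y => f y - g y) x (l - m).
Proof.
move=> /has_derivative_ge0P fx /has_derivative_ge0P gx.
apply/has_derivative_ge0P => e e0; have e20 : 0 < e / 2 by lra.
have [d d0 dP] := fx _ e20; have [d' d'0 dP'] := gx _ e20.
exists (Num.min d d'); first by rewrite lt_min d0.
move=> y y0; rewrite lt_min => /andP[/(dP y y0) fy /(dP' y y0) gy].
have -> : f y - g y - (f x - g x) - (l - m) * (y - x) =
  (f y - f x - l * (y - x)) - (g y - g x - m * (y - x)) by ring.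
by apply: (le_trans (ler_normB _ _)); lra.
Qed.

Lemma has_derivative_ge0_quad a b z x :
  has_derivative_ge0 (fun y => a * y + b * (y - z) ^+ 2) x
    (a + 2 * b * (x - z)).
Proof.
apply/has_derivative_ge0P => e e0.
have b0 : 0 < `|b| + 1 by rewrite ltr_pwDr.
exists (e / (`|b| + 1)); first by rewrite divr_gt0.
move=> y y0; rewrite ltr_pdivlMr// => yxd.
have -> : a * y + b * (y - z) ^+ 2 - (a * x + b * (x - z) ^+ 2) -
  (a + 2 * b * (x - z)) * (y - x) = b * (y - x) * (y - x) by ring.
rewrite 2!normrM ler_wpM2r//.
by have := normr_ge0 (y - x); lra.
Qed.

Lemma has_derivative_ge0_cvg f x l : has_derivative_ge0 f x l ->
  forall e, 0 < e -> exists2 d, 0 < d &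
    forall y, 0 <= y -> `|y - x| < d -> `|f y - f x| < e.
Proof.
move=> /has_derivative_ge0P fx e e0; have [d d0 dP] := fx _ ltr01.
have l0 : 0 < `|l| + 1 by rewrite ltr_pwDr.
exists (Num.min d (e / (`|l| + 1))); first by rewrite lt_min d0 divr_gt0.
move=> y y0; rewrite lt_min ltr_pdivlMr// => /andP[/(dP y y0) fy yx].
have -> : f y - f x = (f y - f x - l * (y - x)) + l * (y - x) by ring.
by apply: (le_lt_trans (ler_normD _ _)); rewrite normrM; lra.
Qed.

Lemma has_derivative_ge0_continuous f df a b :
  (forall x, 0 <= x -> has_derivative_ge0 f x (df x)) -> 0 <= a ->
  {within `[a, b], continuous f}.
Proof.
move=> fdf a0; apply/subspace_continuousP => x.
rewrite /= in_itv /= => /andP[ax _].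
apply/cvgrPdist_lt => e e0.
have [d d0 dP] := has_derivative_ge0_cvg (fdf x (le_trans a0 ax)) e0.
apply/nbhs_ballP; exists d => //= y; rewrite -ball_normE /= distrC => yxd.
by rewrite in_itv /= distrC => /andP[/(le_trans a0) y0 _]; exact: dP.
Qed.

(** A ball of radius at most [x] around [x] stays in the half-line, so the restricted limit is
    two-sided. *)
Lemma has_derivative_ge0_is_derive f x l : 0 < x ->
  has_derivative_ge0 f x l -> is_derive x 1 f l.
Proof.
move=> x0 /has_derivative_ge0P fx.
have cv : h^-1 *: ((f \o shift x) (h *: (1 : R)) - f x) @[h --> (0 : R)^'] --> l.
  apply/cvgrPdist_le => e e0; have [d d0 dP] := fx e e0.
  apply/nbhs_ballP; exists (Num.min d x); first by rewrite /= lt_min d0.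
  move=> h; rewrite -ball_normE /= sub0r normrN lt_min => /andP[hd hx] h0.
  rewrite -normrN opprB -(@ler_pM2r _ `|h|) ?normr_gt0//.
  have := dP (h + x); rewrite addrK => /(_ _ hd).
  have -> : 0 <= h + x by have := ler_norm (- h); rewrite normrN; lra.
  rewrite -normrM mulrBl [h%:A]mulr1 [h^-1 *: _]mulrC divfK//.
  by apply.
by apply: DeriveDef; [apply/cvg_ex; exists l | exact/cvg_lim].
Qed.

(** The two-sided derivative is required only inside the open interval, so [a = 0] is allowed. *)
Lemma MVT_ge0 f df a b :
  (forall x, 0 <= x -> has_derivative_ge0 f x (df x)) -> 0 <= a -> a < b ->
  exists2 c, a < c < b & f b - f a = df c * (b - a).
Proof.
move=> fdf a0 ab.
have fder x : x \in `]a, b[%R -> is_derive x 1 f (df x).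
  rewrite in_itv /= => /andP[ax _]; have x0 := le_lt_trans a0 ax.
  by apply: has_derivative_ge0_is_derive => //; exact/fdf/ltW.
have [c] := MVT ab fder (has_derivative_ge0_continuous (b := b) fdf a0).
by rewrite in_itv /=; exists c.
Qed.

(** Two mean value arguments: one makes [df] strongly monotone, the other integrates this to a
    quadratic lower bound. All later uses of strong convexity rest on this bound. *)
Lemma strongly_convex_ge0_tangent mu f : strongly_convex_ge0 mu f ->
  exists df : R -> R,
    (forall x, 0 <= x -> has_derivative_ge0 f x (df x)) /\
    forall x y, 0 <= x -> 0 <= y ->
      f x + df x * (y - x) + mu / 2 * (y - x) ^+ 2 <= f y.
Proof.
move=> [df [ddf [fdf dfddf ddfmu]]]; exists df; split=> // x y x0 y0.
have mono a b : 0 <= a -> a <= b -> mu * (b - a) <= df b - df a.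
  move=> a0; rewrite le_eqVlt => /predU1P[->|ab]; first by rewrite !subrr mulr0.
  have [c /andP[ac _] ->] := MVT_ge0 dfddf a0 ab.
  by rewrite ler_wpM2r ?subr_ge0 ?(ltW ab)// ddfmu// (le_trans a0) ?ltW.
(* Up to a constant, [h] is [f] minus its quadratic model at [x]; by [mono] its derivative is
   nonpositive before [x] and nonnegative after. *)
pose h s := f s - (df x * s + mu / 2 * (s - x) ^+ 2).
have hdh s : 0 <= s ->
    has_derivative_ge0 h s (df s - (df x + 2 * (mu / 2) * (s - x))).
  by move=> s0; apply/has_derivative_ge0B/has_derivative_ge0_quad/fdf.
suff : h x <= h y by rewrite /h; nra.
have [xy|yx|->//] := ltgtP x y.
  have [c /andP[xc _] e] := MVT_ge0 hdh x0 xy.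
  by rewrite -subr_ge0 e; have := mono x c x0 (ltW xc); nra.
have [c /andP[yc cx] e] := MVT_ge0 hdh y0 yx.
rewrite -subr_le0 e; have := mono c x (le_trans y0 (ltW yc)) (ltW cx); nra.
Qed.

End calculus_ge0.

(** * Best responses and smoothness of the conjugates *)

Section best_response_theory.
Variable R : realType.
Implicit Types (f : R -> R) (x y l p q mu : R).

(** Average the tangent bounds at the mixed point with weights [1 - t] and [t]: the linear terms
    cancel, and the squares combine by [(1-t) t^2 + t (1-t)^2 = t (1-t)]. *)
Lemma strongly_convex_ge0_ineq mu f x y t : strongly_convex_ge0 mu f ->
  0 <= x -> 0 <= y -> 0 <= t <= 1 ->
  f ((1 - t) * x + t * y) + mu / 2 * (t * (1 - t)) * (y - x) ^+ 2
    <= (1 - t) * f x + t * f y.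
Proof.
move=> /strongly_convex_ge0_tangent[df [_ tan]] x0 y0 /andP[t0 t1].
have t1' : 0 <= 1 - t by rewrite subr_ge0.
set z := (1 - t) * x + t * y; have z0 : 0 <= z by rewrite addr_ge0 ?mulr_ge0.
have := lerD (ler_wpM2l t1' (tan z x z0 x0)) (ler_wpM2l t0 (tan z y z0 y0)).
apply: le_trans; rewrite le_eqVlt; apply/orP; left; apply/eqP.
by rewrite /z; field.
Qed.

Lemma increasing_strongly_convex_ge0_lt mu f x : 0 < mu ->
  increasing_ge0 f -> strongly_convex_ge0 mu f -> 0 < x -> f 0 < f x.
Proof.
move=> mu0 fi fs x0.
have h : 0 <= (2^-1 : R) <= 1 by lra.
have := strongly_convex_ge0_ineq fs (lexx 0) (ltW x0) h.
have : f 0 <= f ((1 - 2^-1) * 0 + 2^-1 * x) by apply: fi => //; lra.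
have : 0 < mu / 2 * (2^-1 * (1 - 2^-1)) * (x - 0) ^+ 2.
  by rewrite subr0 !mulr_gt0 ?exprn_gt0//; lra.
lra.
Qed.

Lemma best_responseP mu f p : 0 < mu -> strongly_convex_ge0 mu f ->
  is_best_response f p (best_response f p).
Proof.
move=> mu0 /strongly_convex_ge0_tangent[df [fdf tan]].
suff [x xP] : exists x, is_best_response f p x by exact: (@xgetPex _ 0 _ (ex_intro _ x xP)).
(* The null square puts the linear part in the form of [has_derivative_ge0_quad]. *)
pose g z := p * z + 0 * (z - 0) ^+ 2 - f z.
have gdg z : 0 <= z -> has_derivative_ge0 g z (p + 2 * 0 * (z - 0) - df z).
  by move=> z0; exact/has_derivative_ge0B/fdf/z0/has_derivative_ge0_quad.
have gE z : g z = p * z - f z by rewrite /g; ring.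
(* Beyond [M] the quadratic growth of [f] outweighs the slope [p - df 0], so the objective is at
   most its value at 0 and the maximum over [[0, M]] is global. *)
pose M := 2 * `|p - df 0| / mu.
have M0 : 0 <= M by rewrite divr_ge0 ?mulr_ge0 ?(ltW mu0).
have [x] := EVT_max M0 (has_derivative_ge0_continuous (b := M) gdg (lexx 0)).
rewrite in_itv /= => /andP[x0 _] xmax; exists x; split=> // z z0.
rewrite -!gE; have [zM|Mz] := leP z M; first by apply: xmax; rewrite in_itv /= z0.
apply: (@le_trans _ _ (g 0)); last by apply: xmax; rewrite in_itv /= lexx.
rewrite !gE; have := tan 0 z (lexx 0) z0.
have : (p - df 0) * z <= mu / 2 * (z - 0) ^+ 2.
  move: Mz; rewrite /M ltr_pdivrMr// subr0 expr2 mulrA => Mz.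
  by rewrite ler_wpM2r//; have := ler_norm (p - df 0); lra.
lra.
Qed.

Lemma best_response_ge0 mu f p : 0 < mu -> strongly_convex_ge0 mu f ->
  0 <= best_response f p.
Proof. by move=> mu0 fs; have [] := best_responseP p mu0 fs. Qed.

(** Compare the maximizer with the point a fraction [t] of the way to [y], divide by [t] and let [t]
    tend to 0. *)
Lemma best_response_gap mu f p y : 0 < mu -> strongly_convex_ge0 mu f ->
  0 <= y ->
  p * y - f y + mu / 2 * (y - best_response f p) ^+ 2
    <= p * best_response f p - f (best_response f p).
Proof.
move=> mu0 fs y0; have [x0 xmax] := best_responseP p mu0 fs.
move: (best_response f p) x0 xmax => x x0 xmax.
set B := mu / 2 * _; set A := p * y - f y - (p * x - f x).
suff AB t : 0 < t -> t <= 1 -> A + B <= B * t.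
  suff : A + B <= 0 by rewrite /A; lra.
  apply/ler_addgt0Pr => e e0; rewrite add0r.
  have B0 : 0 <= B by rewrite /B mulr_ge0 ?sqr_ge0//; lra.
  have B1 : 0 < B + e by lra.
  (* This [t] gives [B * t <= e] and stays in [(0, 1]] even if [B = 0]. *)
  have t0 : 0 < e / (B + e) by rewrite divr_gt0.
  have t1 : e / (B + e) <= 1 by rewrite ler_pdivrMr//; lra.
  apply: (le_trans (AB _ t0 t1)).
  by rewrite mulrA ler_pdivrMr// mulrC ler_pM2l//; lra.
move=> t0 t1; have t01 : 0 <= t <= 1 by rewrite ltW.
have z0 : 0 <= (1 - t) * x + t * y by rewrite addr_ge0 ?mulr_ge0 ?subr_ge0 ?(ltW t0).
have := strongly_convex_ge0_ineq fs x0 y0 t01; have := xmax _ z0.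
move: (f _) => fz h1 h2; rewrite -(ler_pM2l t0) /A /B.
nra.
Qed.

(* Smoothness of the conjugate g q = max_x (q x - f x), whose linearization at p,
   g p + g' p (q - p), is q x(p) - f (x(p)). *)
Lemma conjugate_smooth mu L f p q : 0 < mu -> strongly_convex_ge0 mu f ->
  mu^-1 <= L ->
  q * best_response f q - f (best_response f q)
    <= q * best_response f p - f (best_response f p) + L / 2 * (q - p) ^+ 2.
Proof.
move=> mu0 fs muL.
have := best_response_gap p mu0 fs (best_response_ge0 q mu0 fs).
move: (best_response f p) (best_response f q) => x y gap.
suff : (q - p) * (y - x) <= mu / 2 * (y - x) ^+ 2 + L / 2 * (q - p) ^+ 2 by lra.
(* Young's inequality, weighted so that its [(y - x)^2] term is exactly the gain in [gap]. *)
have : 0 <= mu / 2 * ((y - x) - mu^-1 * (q - p)) ^+ 2.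
  by rewrite mulr_ge0 ?sqr_ge0//; lra.
have : mu^-1 * (q - p) ^+ 2 <= L * (q - p) ^+ 2 by rewrite ler_wpM2r ?sqr_ge0.
have -> : mu / 2 * (y - x - mu^-1 * (q - p)) ^+ 2 =
  mu / 2 * (y - x) ^+ 2 - (q - p) * (y - x) + mu^-1 * (q - p) ^+ 2 / 2.
  by field; rewrite gt_eqF.
lra.
Qed.

(** Sum the tangent bounds at the mean; their linear terms cancel. *)
Lemma jensen_ge0 mu f (N : nat) (w : nat -> R) : strongly_convex_ge0 mu f ->
  0 < mu -> (0 < N)%N -> (forall t, 0 <= w t) ->
  N%:R * f (N%:R^-1 * \sum_(0 <= t < N) w t) <= \sum_(0 <= t < N) f (w t).
Proof.
move=> /strongly_convex_ge0_tangent[df [_ tan]] mu0 N0 w0.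
have N0' : (N%:R : R) != 0 by rewrite pnatr_eq0 -lt0n.
set z := _^-1 * _.
have z0 : 0 <= z by rewrite mulr_ge0 ?invr_ge0 ?sumr_ge0.
have : \sum_(0 <= t < N) (f z + df z * (w t - z)) <= \sum_(0 <= t < N) f (w t).
  apply: ler_sum => t _; apply: le_trans (tan z (w t) z0 (w0 t)).
  by rewrite lerDl mulr_ge0 ?sqr_ge0//; lra.
apply: le_trans; rewrite big_split /= -mulr_sumr sumrB !sumr_const_nat subn0.
have -> : \sum_(0 <= t < N) w t = z *+ N.
  by rewrite -[RHS]mulr_natl /z mulrA divff// mul1r.
by rewrite subrr mulr0 addr0 mulr_natl.
Qed.

End best_response_theory.

(** * Weak duality and its perturbed form *)

Section composite_method.
Variables (R : realType) (n : nat) (n_gt0 : (0 < n)%N).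
Implicit Types (f : 'I_n -> R -> R) (C mu a c : R) (x p q z : 'rV[R]_n).

Lemma min_entry_le p k : min_entry n_gt0 p <= p 0 k.
Proof. exact: bigmin_le_cond. Qed.

Lemma le_min_entry m p : (forall k, m <= p 0 k) -> m <= min_entry n_gt0 p.
Proof. by move=> mp; apply/bigmin_geP. Qed.

Lemma min_entry_ge0 p : nonneg_vec p -> 0 <= min_entry n_gt0 p.
Proof. exact: le_min_entry. Qed.

Lemma response_ge0 f mu p : 0 < mu ->
  (forall k, strongly_convex_ge0 mu (f k)) -> nonneg_vec (response f p).
Proof. by move=> mu0 fs k; rewrite mxE; exact: (best_response_ge0 _ mu0 (fs k)). Qed.

(** For fixed [z] this minorant is linear in [p] apart from the minimum; it serves both weak duality
    and Jensen's inequality for the dual. *)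
Lemma dual_obj_ge f C mu p z : 0 < mu ->
  (forall k, strongly_convex_ge0 mu (f k)) -> nonneg_vec z ->
  \sum_(k < n) (p 0 k * z 0 k - f k (z 0 k)) - C * min_entry n_gt0 p
    <= dual_obj n_gt0 f C p.
Proof.
move=> mu0 fs z0; rewrite lerD2r; apply: ler_sum => k _; rewrite mxE.
by have [_] := best_responseP (p 0 k) mu0 (fs k); exact.
Qed.

Lemma weak_duality f C mu p z : 0 < mu ->
  (forall k, strongly_convex_ge0 mu (f k)) -> nonneg_vec p -> nonneg_vec z ->
  C <= \sum_(k < n) z 0 k -> - primal_obj f z <= dual_obj n_gt0 f C p.
Proof.
move=> mu0 fs p0 z0 Cz; apply: le_trans (dual_obj_ge C p mu0 fs z0).
rewrite sumrB [leRHS]addrAC -[leLHS]add0r lerD2r subr_ge0.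
apply: (@le_trans _ _ ((\sum_(k < n) z 0 k) * min_entry n_gt0 p)).
  by rewrite ler_wpM2r// min_entry_ge0.
rewrite mulr_suml; apply: ler_sum => k _.
by rewrite mulrC ler_wpM2r// min_entry_le.
Qed.

(* Mixing [x] with the point [2C/n, ..., 2C/n], at which the constraint holds
   with slack [C], restores feasibility at a cost proportional to the violation
   of [x]. *)
Lemma perturbed_weak_duality f C mu p x : 0 < C -> 0 < mu ->
  (forall k, increasing_ge0 (f k)) -> (forall k, strongly_convex_ge0 mu (f k)) ->
  nonneg_vec p -> nonneg_vec x ->
  - (pos_part (C - \sum_(k < n) x 0 k) * (pmax f C / n%:R))
    <= dual_obj n_gt0 f C p + primal_obj f x.
Proof.
move=> C0 mu0 fi fs p0 x0; have n0 : 0 < n%:R :> R by rewrite ltr0n.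
set s := pos_part _; have s0 : 0 <= s by rewrite le_max lexx orbT.
have sC : C - s <= \sum_(k < n) x 0 k by rewrite lerBlDl -lerBlDr le_max lexx.
(* The weight solves [(1 - th) (C - s) + th * 2C = C]. *)
pose th := s / (C + s); pose b := 2 * C / n%:R.
have Cs0 : 0 < C + s by rewrite ltr_pwDl.
have th0 : 0 <= th by rewrite divr_ge0// ltW.
have th1 : th <= 1 by rewrite ler_pdivrMr// mul1r lerDr ltW.
have b0 : 0 <= b by rewrite divr_ge0 ?mulr_ge0// ltW.
have th01 : 0 <= th <= 1 by rewrite th0.
pose z : 'rV[R]_n := \row_k ((1 - th) * x 0 k + th * b).
have z0 : nonneg_vec z.
  by move=> k; rewrite mxE; apply: addr_ge0; apply: mulr_ge0; rewrite ?subr_ge0.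
have Cz : C <= \sum_(k < n) z 0 k.
  under eq_bigr do rewrite mxE.
  rewrite big_split /= -mulr_sumr sumr_const card_ord -[th * b *+ n]mulr_natr.
  rewrite -[th * b * _]mulrA /b divfK ?gt_eqF//.
  have : (1 - th) * (C - s) <= (1 - th) * \sum_(k < n) x 0 k.
    by rewrite ler_wpM2l ?subr_ge0.
  have : th * (C + s) = s by rewrite divfK ?gt_eqF.
  by lra.
have fz : primal_obj f z <=
    (1 - th) * primal_obj f x + th * \sum_(k < n) f k b.
  rewrite /primal_obj !mulr_sumr -big_split /=; apply: ler_sum => k _.
  rewrite mxE; apply: le_trans (strongly_convex_ge0_ineq (fs k) (x0 k) b0 th01).
  rewrite lerDl; apply: mulr_ge0; last exact: sqr_ge0.
  by apply: mulr_ge0; [lra | apply: mulr_ge0; rewrite ?subr_ge0].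
have f0 : \sum_(k < n) f k 0 <= primal_obj f x.
  by apply: ler_sum => k _; exact: fi.
have fb : \sum_(k < n) f k 0 <= \sum_(k < n) f k b.
  by apply: ler_sum => k _; exact: fi.
have -> : pmax f C / n%:R = (\sum_(k < n) f k b - \sum_(k < n) f k 0) / C.
  by rewrite /pmax -/b; field; rewrite !gt_eqF.
have thC : th <= s / C by rewrite ler_wpM2l// lef_pV2 ?posrE// lerDl.
have := weak_duality mu0 fs p0 z0 Cz.
have : th * (\sum_(k < n) f k b - \sum_(k < n) f k 0) <=
       s / C * (\sum_(k < n) f k b - \sum_(k < n) f k 0).
  by rewrite ler_wpM2r ?subr_ge0.
have : th * \sum_(k < n) f k 0 <= th * primal_obj f x by rewrite ler_wpM2l.
have -> : s * ((\sum_(k < n) f k b - \sum_(k < n) f k 0) / C) =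
          s / C * (\sum_(k < n) f k b - \sum_(k < n) f k 0) by ring.
by lra.
Qed.

(** * One step of the composite gradient method *)

Lemma Lpsi_gt0 mu : 0 < mu -> 0 < Lpsi n mu.
Proof. by move=> mu0; rewrite divr_gt0// ltr0n. Qed.

Lemma invr_le_Lpsi mu : 0 < mu -> mu^-1 <= Lpsi n mu.
Proof. by move=> mu0; rewrite ler_pMl ?invr_gt0// ler1n. Qed.

Lemma composite_step_ge0 f C mu p p' :
  composite_step f C mu p p' -> nonneg_vec p'.
Proof.
move=> [c [cP p'E]] k; rewrite p'E le_max.
by move: cP; rewrite /is_pcenter; case: ifP => [_ ->|_ [/ltW ->]]; rewrite ?lexx.
Qed.

(* Optimality of the prox step, tested on the constant vector [a]: the moved
   coordinates all end at [c], and [C / Lpsi] is their total displacement unless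
   the constraint [0 <= c] is active. *)
Lemma pcenter_optimality C mu q p' c a : 0 < C -> 0 < mu -> 0 <= a ->
  is_pcenter C mu q c -> (forall k, p' 0 k = Num.max c (q 0 k)) ->
  Lpsi n mu * \sum_(k < n) (p' 0 k - q 0 k) * (p' 0 k - a)
    <= C * (min_entry n_gt0 p' - a).
Proof.
move=> C0 mu0 a0 cP p'E; have L0 := Lpsi_gt0 mu0.
have cmin : c <= min_entry n_gt0 p'.
  by apply: le_min_entry => k; rewrite p'E le_max lexx.
have -> : \sum_(k < n) (p' 0 k - q 0 k) * (p' 0 k - a) =
    (\sum_(k < n) pos_part (c - q 0 k)) * (c - a).
  rewrite mulr_suml; apply: eq_bigr => k _; rewrite p'E /pos_part.
  have [cq|qc] := leP c (q 0 k).
    by rewrite max_r ?subr_le0// subrr !mul0r.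
  by rewrite max_l ?subr_ge0 ?ltW.
apply: (@le_trans _ _ (C * (c - a))); last first.
  by rewrite ler_pM2l// lerD2r.
(* The total displacement can exceed [C / Lpsi] only when [c = 0], where the factor [c - a = - a] is
   nonpositive. *)
rewrite mulrA; move: cP; rewrite /is_pcenter; case: ifP => [CS c0|_ [_ ->]].
  subst c; under eq_bigr do rewrite sub0r.
  rewrite sub0r !mulrN lerN2 ler_wpM2r//.
  by rewrite mulrC -ler_pdivrMr.
by rewrite [X in X * _]mulrC divfK ?gt_eqF.
Qed.

(** Smoothness bounds the conjugates at [p'] by their linearizations at [p], and the three-point
    identity turns the prox term into a difference of squared distances to [a]. *)
Lemma composite_step_descent f C mu p p' a : 0 < C -> 0 < mu ->
  (forall k, strongly_convex_ge0 mu (f k)) -> 0 <= a ->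
  composite_step f C mu p p' ->
  dual_obj n_gt0 f C p' + primal_obj f (response f p)
    <= a * (\sum_(k < n) response f p 0 k - C)
       + Lpsi n mu / 2 * (\sum_(k < n) (a - p 0 k) ^+ 2
                          - \sum_(k < n) (a - p' 0 k) ^+ 2).
Proof.
move=> C0 mu0 fs a0 [c [cP p'E]].
have := pcenter_optimality C0 mu0 a0 cP p'E; rewrite /gradient_step.
have L0 := Lpsi_gt0 mu0; have muL := invr_le_Lpsi mu0.
move: (Lpsi n mu) L0 muL {cP p'E} => L L0 muL.
set q := p - _ => opt.
(* The term [C * min_entry] in [opt] cancels the one in the dual objective. *)
suff : \sum_(k < n) (p' 0 k * response f p' 0 k - f k (response f p' 0 k))
    + primal_obj f (response f p) <=
    a * \sum_(k < n) response f p 0 k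
    + L / 2 * (\sum_(k < n) (a - p 0 k) ^+ 2 - \sum_(k < n) (a - p' 0 k) ^+ 2)
    + L * \sum_(k < n) (p' 0 k - q 0 k) * (p' 0 k - a).
  by rewrite /dual_obj; lra.
rewrite /primal_obj -!sumrB !mulr_sumr -!big_split /=.
apply: ler_sum => k _; rewrite /q !mxE.
have := conjugate_smooth (p 0 k) (p' 0 k) mu0 (fs k) muL.
move: (best_response _ (p 0 k)) (best_response _ (p' 0 k)) => xk yk smooth.
have -> : L * ((p' 0 k - (p 0 k - L^-1 * xk)) * (p' 0 k - a)) =
    L * (p' 0 k - p 0 k) * (p' 0 k - a) + xk * (p' 0 k - a).
  by field; rewrite gt_eqF.
by lra.
Qed.

(** * Averaged iterates and summation over the steps *)

Lemma x_avgE f N (p : nat -> 'rV[R]_n) k :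
  x_avg f N p 0 k = N%:R^-1 * \sum_(0 <= t < N) response f (p t) 0 k.
Proof. by rewrite mxE summxE. Qed.

(** The shift of index pairs [p t.+1] with [response f (p t)], as in one step. *)
Lemma p_avgE N (p : nat -> 'rV[R]_n) k :
  p_avg N p 0 k = N%:R^-1 * \sum_(0 <= t < N) p t.+1 0 k.
Proof. by rewrite mxE summxE big_add1. Qed.

Lemma primal_obj_x_avg f mu N (p : nat -> 'rV[R]_n) : 0 < mu -> (0 < N)%N ->
  (forall k, strongly_convex_ge0 mu (f k)) ->
  N%:R * primal_obj f (x_avg f N p)
    <= \sum_(0 <= t < N) primal_obj f (response f (p t)).
Proof.
move=> mu0 N0 fs; rewrite /primal_obj mulr_sumr exchange_big /=.
apply: ler_sum => k _; rewrite x_avgE; apply: (jensen_ge0 (fs k)) => // t.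
exact: (response_ge0 _ mu0 fs).
Qed.

(** Freeze [z] at the response to the average: the linear part averages exactly, and the minimum
    entry is concave. *)
Lemma dual_obj_p_avg f C mu N (p : nat -> 'rV[R]_n) : 0 < C -> 0 < mu ->
  (0 < N)%N -> (forall k, strongly_convex_ge0 mu (f k)) ->
  N%:R * dual_obj n_gt0 f C (p_avg N p)
    <= \sum_(0 <= t < N) dual_obj n_gt0 f C (p t.+1).
Proof.
move=> C0 mu0 N0 fs; have N0' : N%:R != 0 :> R by rewrite pnatr_eq0 -lt0n.
have NV0 : 0 < N%:R :> R by rewrite ltr0n.
set z := response f (p_avg N p).
have z0 : nonneg_vec z by exact: (response_ge0 _ mu0 fs).
have : \sum_(0 <= t < N) (\sum_(k < n) (p t.+1 0 k * z 0 k - f k (z 0 k))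
      - C * min_entry n_gt0 (p t.+1)) <=
    \sum_(0 <= t < N) dual_obj n_gt0 f C (p t.+1).
  by apply: ler_sum => t _; exact: (dual_obj_ge C _ mu0 fs z0).
apply: le_trans; rewrite /dual_obj -/z mulrBr [leRHS]sumrB lerB//.
  rewrite exchange_big mulr_sumr /=; apply: ler_sum => k _.
  rewrite sumrB -mulr_suml sumr_const_nat subn0 p_avgE mulrBr 2!mulrA.
  by rewrite divff// mul1r mulr_natl.
rewrite -mulr_sumr mulrCA ler_pM2l// mulrC -ler_pdivrMr//.
apply: le_min_entry => k; rewrite p_avgE mulrC ler_pM2l ?invr_gt0//.
by apply: ler_sum => t _; exact: min_entry_le.
Qed.

Lemma composite_run_bound f C mu N (p : nat -> 'rV[R]_n) a : 0 < C ->
  0 < mu -> (0 < N)%N -> (forall k, strongly_convex_ge0 mu (f k)) -> 0 <= a ->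
  composite_run f C mu N p ->
  N%:R * (dual_obj n_gt0 f C (p_avg N p) + primal_obj f (x_avg f N p)
          + a * (C - \sum_(k < n) x_avg f N p 0 k))
    <= Lpsi n mu / 2 * \sum_(k < n) (a - p 0%N 0 k) ^+ 2.
Proof.
move=> C0 mu0 N0 fs a0 run; have N0' : N%:R != 0 :> R by rewrite pnatr_eq0 -lt0n.
pose d t : R := \sum_(k < n) (a - p t 0 k) ^+ 2.
have : \sum_(0 <= t < N)
      (dual_obj n_gt0 f C (p t.+1) + primal_obj f (response f (p t))) <=
    \sum_(0 <= t < N) (a * (\sum_(k < n) response f (p t) 0 k - C)
      + Lpsi n mu / 2 * (d t - d t.+1)).
  rewrite !big_nat; apply: ler_sum => t tN; apply: composite_step_descent => //.
  exact: run.
rewrite [leLHS]big_split [leRHS]big_split /= -!mulr_sumr.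
rewrite [X in a * X]sumrB sumr_const_nat subn0.
have -> : \sum_(0 <= t < N) (d t - d t.+1) = d 0%N - d N.
  apply: oppr_inj; rewrite opprB -telescope_sumr// -sumrN.
  by apply: eq_bigr => t _; rewrite opprB.
have -> : \sum_(0 <= t < N) \sum_(k < n) response f (p t) 0 k =
    N%:R * \sum_(k < n) x_avg f N p 0 k.
  rewrite exchange_big mulr_sumr /=; apply: eq_bigr => k _.
  by rewrite x_avgE mulVKf.
(* After telescoping, the final distance has a favourable sign and is dropped. *)
have dN : 0 <= Lpsi n mu / 2 * d N.
  have L0 := Lpsi_gt0 mu0; apply: mulr_ge0; first lra.
  by apply: sumr_ge0 => k _; exact: sqr_ge0.
have := dual_obj_p_avg p C0 mu0 N0 fs; have := primal_obj_x_avg p mu0 N0 fs.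
rewrite -[C *+ N]mulr_natl -/(d 0%N); lra.
Qed.

End composite_method.

(** * Convergence rate *)

Lemma sum_sqr_dist_le (R : realType) (n : nat) (p : 'rV[R]_n) a P M :
  (forall k, 0 <= p 0 k <= P) -> 0 <= a <= M -> P <= M ->
  \sum_(k < n) (a - p 0 k) ^+ 2 <= n%:R * M ^+ 2.
Proof.
move=> pP aM PM; have -> : n%:R * M ^+ 2 = \sum_(k < n) M ^+ 2.
  by rewrite sumr_const card_ord mulr_natl.
by apply: ler_sum => k _; have := pP k; nra.
Qed.

Theorem theorem2 (R : realType) (n : nat) (n_gt0 : (0 < n)%N) (C mu : R)
    (C_gt0 : 0 < C) (mu_gt0 : 0 < mu) (f : 'I_n -> R -> R)
    (f_incr : forall k, increasing_ge0 (f k))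
    (f_sconv : forall k, strongly_convex_ge0 mu (f k))
    (xstar ystar pstar : 'rV[R]_n)
    (xstar_opt : primal_optimal f C xstar ystar)
    (pstar_opt : dual_optimal n_gt0 f C pstar)
    (N : nat) (N_gt0 : (0 < N)%N) (p : nat -> 'rV[R]_n)
    (p0_bounds : forall k, 0 <= p 0%N 0 k <= pmax f C)
    (p_run : composite_run f C mu N p) :
  let phat := p_avg N p in
  let xhat := x_avg f N p in
  let phi := dual_obj n_gt0 f C in
  [/\ primal_obj f xhat - primal_obj f xstar <= primal_obj f xhat + phi pstar,
      primal_obj f xhat + phi pstar <= phi phat + primal_obj f xhat,
      phi phat + primal_obj f xhat
        <= 82 * pmax f C ^+ 2 * n%:R ^+ 2 / (N%:R * mu) &
      pos_part (C - \sum_(k < n) xhat 0 k)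
        <= 82 * pmax f C * n%:R ^+ 2 / (3 * N%:R * mu)].
Proof.
move=> phat xhat phi; have [[Cy yx _ xstar0] _] := xstar_opt.
have [pstar0 pstar_min] := pstar_opt.
have N0 : 0 < N%:R :> R by rewrite ltr0n.
have n1 : 1 <= n%:R :> R by rewrite ler1n.
have n0 : 0 < n%:R :> R by rewrite ltr0n.
have phat0 : nonneg_vec phat.
  move=> k; rewrite p_avgE mulr_ge0 ?invr_ge0 ?(ltW N0)// big_nat sumr_ge0// => t tN.
  exact: (composite_step_ge0 (p_run t tN)).
have xhat0 : nonneg_vec xhat.
  move=> k; rewrite x_avgE mulr_ge0 ?invr_ge0 ?(ltW N0)// sumr_ge0// => t _.
  exact: (response_ge0 _ mu_gt0 f_sconv).
(* Strict positivity permits the final cancellation of [P]. *)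
have P0 : 0 < pmax f C.
  have lt k : 0 < f k (2 * C / n%:R) - f k 0.
    rewrite subr_gt0; apply: (increasing_strongly_convex_ge0_lt mu_gt0) => //.
    by rewrite divr_gt0 ?mulr_gt0.
  rewrite /pmax mulr_gt0 ?divr_gt0// -sumrB (bigD1 (Ordinal n_gt0))//=.
  by rewrite ltr_pwDl// sumr_ge0// => k _; exact/ltW.
set P := pmax f C in P0 *.
have bound a : 0 <= a -> forall M, a <= M -> P <= M ->
    phi phat + primal_obj f xhat + a * (C - \sum_(k < n) xhat 0 k)
      <= M ^+ 2 * n%:R ^+ 2 / (2 * (N%:R * mu)).
  move=> a0 M aM PM.
  have := composite_run_bound n_gt0 C_gt0 mu_gt0 N_gt0 f_sconv a0 p_run.
  have aM' : 0 <= a <= M by rewrite a0.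
  have L20 : 0 <= Lpsi n mu / 2 by rewrite divr_ge0// ltW// Lpsi_gt0.
  have := ler_wpM2l L20 (sum_sqr_dist_le p0_bounds aM' PM).
  move=> h1 /le_trans/(_ h1); rewrite mulrC -ler_pdivlMr// => /le_trans; apply.
  by rewrite le_eqVlt /Lpsi; apply/orP/or_introl/eqP; field; rewrite !gt_eqF.
have K0 : 0 <= n%:R ^+ 2 / (N%:R * mu) by rewrite divr_ge0 ?sqr_ge0// mulr_ge0 ?ltW.
split.
- rewrite lerD2l; apply: (weak_duality n_gt0 mu_gt0 f_sconv pstar0 xstar0).
  by apply: (le_trans Cy); apply: ler_sum => k _.
- by rewrite addrC lerD2r; exact: pstar_min.
(* With [a = 0] and [M = P] the constant is 1/2, below 82. *)
- have := bound 0 (lexx 0) P (ltW P0) (lexx P); rewrite mul0r addr0.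
  move=> /le_trans; apply; rewrite invfM.
  have : 0 <= P ^+ 2 * (n%:R ^+ 2 / (N%:R * mu)) by rewrite mulr_ge0 ?sqr_ge0.
  lra.
set s := pos_part _.
have s0 : 0 <= s by rewrite le_max lexx orbT.
have [sE|sE] : s = 0 \/ s = C - \sum_(k < n) xhat 0 k.
  by rewrite /s /pos_part; case: leP; [left|right].
  rewrite sE; have -> : 82 * P * n%:R ^+ 2 / (3 * N%:R * mu) =
      82 / 3 * P * (n%:R ^+ 2 / (N%:R * mu)) by field; rewrite !gt_eqF.
  by rewrite mulr_ge0// mulr_ge0 ?(ltW P0)//; lra.
have P20 : 0 <= 2 * P by lra.
have PP2 : P <= 2 * P by lra.
(* The penalty [2 P s] exceeds the possible loss [s P / n <= s P] by at least [s P], so [s P] is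
   bounded; dividing by [P] leaves the constant 2, below 82/3. *)
have := bound (2 * P) P20 (2 * P) (lexx _) PP2; rewrite -sE.
have := perturbed_weak_duality n_gt0 C_gt0 mu_gt0 f_incr f_sconv phat0 xhat0.
rewrite -/s -/phi -/P => lb ub.
have sP : s * (P / n%:R) <= s * P.
  by rewrite ler_wpM2l// ler_pdivrMr// ler_peMr// ltW.
have : s * P <= 2 * P ^+ 2 * (n%:R ^+ 2 / (N%:R * mu)).
  have -> : 2 * P ^+ 2 * (n%:R ^+ 2 / (N%:R * mu)) =
     (2 * P) ^+ 2 * n%:R ^+ 2 / (2 * (N%:R * mu)) by field; rewrite !gt_eqF.
  by lra.
have -> : 2 * P ^+ 2 * (n%:R ^+ 2 / (N%:R * mu)) =
  (2 * P * (n%:R ^+ 2 / (N%:R * mu))) * P by ring.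
rewrite ler_pM2r// => /le_trans; apply.
have -> : 82 * P * n%:R ^+ 2 / (3 * N%:R * mu) =
  82 / 3 * (P * (n%:R ^+ 2 / (N%:R * mu))) by field; rewrite !gt_eqF.
have : 0 <= P * (n%:R ^+ 2 / (N%:R * mu)) by rewrite mulr_ge0// ltW.
lra.
Qed.
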